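(* Let $a<b$ be real numbers and let $I=[a,b)$ or $I=[a,\infty)$. For any natural number $n\ge 1$ there exists a function $f_n\colon I\to\mathbf{R}$ such that (1) $f_n$ is matrix monotone of order $n$ on $I$; (2) $f_n$ is not matrix monotone of order $n+1$ on $I$, nor is (the restriction of) $f_n$ matrix monotone of order $n+1$ on any non-trivial subinterval of $I$.
   Context: Let $J\subseteq\mathbf{R}$ be a non-trivial interval (i.e. containing more than one point). A real, continuous function $f\colon J\to\mathbf{R}$ is called matrix monotone of order $n$ on $J$ if for every pair of self-adjoint complex $n\times n$ matrices $x,y$ with eigenvalues in $J$, $x\le y$ implies $f(x)\le f(y)$. Here $f(x)$ is defined by functional calculus and $x\le y$ means that $y-x$ is positive semi-definite. *)

(* Defs.v *)
From HB Require Import structures.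
From mathcomp Require Import all_boot all_order all_algebra.
From mathcomp Require Import sesquilinear spectral complex.
From mathcomp Require Import all_classical all_reals all_analysis.

Set Implicit Arguments.
Unset Strict Implicit.
Unset Printing Implicit Defensive.

Import Order.TTheory GRing.Theory Num.Theory.
Import numFieldNormedType.Exports.

Local Open Scope classical_set_scope.
Local Open Scope ring_scope.
Local Open Scope complex_scope.
Local Open Scope sesquilinear_scope.

Definition psdmx (R : realType) (n : nat) (x : 'M[R[i]]_n) : Prop :=
  x \is hermsymmx /\ forall v : 'cV[R[i]]_n, 0 <= (v ^t* *m x *m v) 0 0.

Definition loewner_le (R : realType) (n : nat) (x y : 'M[R[i]]_n) : Prop :=
  psdmx (y - x).

(* [spectralmx x] is unitary and, for a self-adjoint [x], diagonalizes it, with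
   real eigenvalues [spectral_diag x]; [funcalc_diag] below shows that the
   result does not depend on this choice of a diagonalization. *)
Definition funcalc (R : realType) (n : nat) (f : R -> R) (x : 'M[R[i]]_n) :
    'M[R[i]]_n :=
  invmx (spectralmx x)
    *m diag_mx (map_mx (fun z => (f (complex.Re z))%:C) (spectral_diag x))
    *m spectralmx x.

Lemma funcalc_diag (R : realType) (n : nat) (f : R -> R) (u : 'M[R[i]]_n)
    (d : 'rV[R]_n) : u \is unitarymx ->
  funcalc f (invmx u *m diag_mx (map_mx (real_complex R) d) *m u) =
  invmx u *m diag_mx (map_mx (real_complex R \o f) d) *m u.
Proof.
move=> uU; have uV := unitarymx_unit uU.
set x := invmx u *m _ *m _.
have /orthomx_spectralP : x \is normalmx.
  by apply/orthomx_spectral_subproof; exists (u, map_mx (real_complex R) d).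
rewrite /funcalc; set p := spectralmx x; set e := spectral_diag x.
have pV : p \in unitmx by exact: spectral_unit.
move=> xE; pose w := p *m invmx u.
have wE : diag_mx e *m w = w *m diag_mx (map_mx (real_complex R) d).
  have : p *m x *m invmx u = p *m x *m invmx u by [].
  by rewrite {1}xE {1}/x !mulmxA mulmxV// mul1mx !mulmxK// /w -!mulmxA.
have pE : p = w *m u by rewrite mulmxKV.
move: (w) wE pE => {}w wE pE.
have wfE : diag_mx (map_mx (fun z => (f (complex.Re z))%:C) e) *m w =
           w *m diag_mx (map_mx (real_complex R \o f) d).
  apply/matrixP => i j; move/matrixP/(_ i j): wE.
  rewrite !mul_diag_mx !mul_mx_diag !mxE !(mulrC _ (w i j)).
  by have [->|w0] := eqVneq (w i j) 0; [rewrite !mul0r|move=> /(mulfI w0) ->].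
apply: (can_inj (mulKmx pV)); rewrite !mulmxA mulmxV// mul1mx.
by rewrite pE mulmxA wfE mulmxK.
Qed.

(* Only the values of [f] on [J] matter: [f : R -> R] stands for its restriction
   to [J]. [J] is meant to be a non-trivial interval. *)
Definition matrix_monotone (R : realType) (n : nat) (J : set R) (f : R -> R) :
    Prop :=
  {within J, continuous f} /\
  forall x y : 'M[R[i]]_n,
    x \is hermsymmx -> y \is hermsymmx ->
    (forall z : R[i], eigenvalue x z -> exists2 t, J t & z = t%:C) ->
    (forall z : R[i], eigenvalue y z -> exists2 t, J t & z = t%:C) ->
    loewner_le x y -> loewner_le (funcalc f x) (funcalc f y).

Definition nontrivial_interval (R : realType) (J : set R) : Prop :=
  is_interval J /\ exists s t, [/\ J s, J t & s != t].

(* Main.v *)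
Require Import Defs.
From mathcomp Require Import all_boot all_order all_algebra.
From mathcomp Require Import sesquilinear spectral complex.
From mathcomp Require Import all_classical all_reals all_analysis.
From mathcomp Require Import ring.

Set Implicit Arguments.
Unset Strict Implicit.
Unset Printing Implicit Defensive.

Import Order.TTheory GRing.Theory Num.Theory.
Import numFieldNormedType.Exports.

Local Open Scope classical_set_scope.
Local Open Scope ring_scope.
Local Open Scope sesquilinear_scope.
Local Open Scope complex_scope.

(** The function is a sum of simple poles, on the left of [a],
      [f t = 1 / (t - a + n + 1) - \sum_(j < n) c_j / (t - a + j + 1)],
    with large [c_j > 0]. Each [- 1 / (t + s)] is operator monotone, so [f] is
    an operator monotone function spoiled by a single pole of the wrong sign.

    Everything is read off rank-one perturbations. By the Sherman-Morrison
    formula, with [R_j] the resolvent of [x] at the [j]-th pole,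
    [v^* (f (x + u u^* ) - f x) v = \sum_j c_j |m_j|^2 / (1 + q_j)], where
    [m_j = u^* R_j v], [q_j = u^* R_j u] and [c_n = -1] for the wrong pole
    ([gap_mx_rank1_form]). So the question is whether [m_n] is controlled by
    the other [m_j].

    In dimension [n] it is. If [chi] is the characteristic polynomial of [x], of
    degree [n], and [s_j = j + 1 - a], expanding [chi / \prod_j (t + s_j)] in
    partial fractions and evaluating at [x] gives a linear relation between the
    [n + 1] resolvents, hence between the [m_j]. The pole [- s_n] being the
    farthest from the spectrum, the coefficients expressing [m_n] in terms of
    the other [m_j] are bounded independently of [x], and suitable [c_j] make
    the form nonnegative ([gap_form_ge0]). Any [y >= x] is reached from [x] by
    rank-one steps, so [f] is monotone of order [n] ([gap_fun_monotone]).

    In dimension [n + 1] it is not. For distinct eigenvalues, the same partial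
    fractions with the roles of poles and eigenvalues exchanged give [v] with
    [m_j = 0] for [j < n] but [m_n <> 0] ([gap_annihilator]), and then the form
    is negative. The eigenvalues and the size of the perturbation are free, so
    this happens inside every nontrivial interval ([gap_fun_not_monotone]).

    The function on the half-line restricts to [a <= t < b], which settles both
    cases. *)

(** * Partial fractions and the coefficients *)

Lemma size_prod_XsubC_card (F : fieldType) (I : finType) (A : pred I)
    (c : I -> F) : size (\prod_(i | A i) ('X - (c i)%:P)) = #|A|.+1.
Proof.
rewrite size_prod => [|i _]; last by rewrite polyXsubC_eq0.
under eq_bigr do rewrite size_XsubC.
by rewrite sum_nat_const muln2 -addnn subSn ?leq_addr// addKn.
Qed.

(** Lagrange interpolation of [P] at the [p i], divided by
    [\prod_i ('X - p i)]. *)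
Lemma partial_fractions (F : fieldType) (n : nat) (p : 'I_n.+1 -> F)
    (P : {poly F}) (x : F) :
  injective p -> (size P <= n.+1)%N -> (forall i, x != p i) ->
  P.[x] / \prod_i (x - p i) =
  \sum_i P.[p i] / \prod_(k | k != i) (p i - p k) / (x - p i).
Proof.
move=> p_inj sizeP xp.
pose W i := \prod_(k | k != i) (p i - p k).
pose L i : {poly F} := \prod_(k | k != i) ('X - (p k)%:P).
have W0 i : W i != 0.
  by apply/prodf_neq0 => k ki; rewrite subr_eq0 (inj_eq p_inj) eq_sym.
have LE i y : (L i).[y] = \prod_(k | k != i) (y - p k).
  by rewrite horner_prod; apply: eq_bigr => k _; rewrite hornerXsubC.
have sizeL i : (size (L i) <= n.+1)%N.
  by rewrite size_prod_XsubC_card cardC1 card_ord.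
(* both sides have degree at most [n] and agree at the [n + 1] points [p i] *)
have PE : P = \sum_i (P.[p i] / W i) *: L i.
  apply/eqP; rewrite -subr_eq0; apply/eqP.
  apply: (@roots_geq_poly_eq0 _ _ (map p (enum 'I_n.+1))).
  - apply/allP => _ /mapP[i _ ->]; rewrite /root !hornerE horner_sum.
    rewrite (bigD1 i)//= big1 ?addr0 => [|k ki].
      by rewrite hornerZ LE mulfVK// subrr.
    by rewrite hornerZ LE (bigD1 i) 1?eq_sym//= subrr mul0r mulr0.
  - by rewrite map_inj_uniq ?enum_uniq.
  rewrite size_map size_enum_ord (leq_trans (size_polyD _ _))// geq_max sizeP.
  rewrite size_polyN; apply: (leq_trans (size_sum _ _ _)).
  by apply/bigmax_leqP => i _; exact: leq_trans (size_scale_leq _ _) _.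
rewrite {1}PE horner_sum mulr_suml; apply: eq_bigr => i _.
rewrite hornerZ [X in _ / X = _](bigD1 i)//= -LE invfM (mulrC (x - p i)^-1).
rewrite mulrA mulfK// LE.
by apply/prodf_neq0 => k _; rewrite subr_eq0 xp.
Qed.

Lemma sqr_norm_sum_le (F : numFieldType) (I : finType) (A : pred I)
    (z : I -> F) :
  `|\sum_(i | A i) z i| ^+ 2 <= #|A|%:R * \sum_(i | A i) `|z i| ^+ 2.
Proof.
apply: le_trans (_ : (\sum_(i | A i) `|z i|) ^+ 2 <= _).
  by rewrite ler_pXn2r ?nnegrE ?sumr_ge0//; exact: ler_norm_sum.
set S := \sum_(i | A i) `|z i| ^+ 2.
have -> : #|A|%:R * S = \sum_(i | A i) \sum_(j | A j)
    (`|z i| ^+ 2 + `|z j| ^+ 2) / 2.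
  under eq_bigr do rewrite -mulr_suml big_split/=.
  rewrite -mulr_suml big_split/= exchange_big/= -mulr2n -[_ *+ 2]mulr_natr.
  by rewrite mulfK ?pnatr_eq0// sumr_const mulr_natl.
rewrite expr2 mulr_suml; apply: ler_sum => i _.
rewrite mulr_sumr; apply: ler_sum => j _.
rewrite ler_pdivlMr ?ltr0n// -subr_ge0.
have -> : `|z i| ^+ 2 + `|z j| ^+ 2 - `|z i| * `|z j| * 2 =
   (`|z i| - `|z j|) ^+ 2 by ring.
by rewrite real_exprn_even_ge0// rpredB ?normr_real.
Qed.

(** The Lagrange denominator at the point [- (j + 1)] among
    [-1, ..., - (n + 1)]. *)
Definition gap_weight (F : fieldType) (n : nat) (j : 'I_n.+1) : F :=
  \prod_(k < n.+1 | k != j) (k%:R - j%:R).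

(** The other poles must outweigh the last one. The squared ratio of Lagrange
    denominators bounds the squared coefficients of the relation between
    resolvents, [n] is the Cauchy-Schwarz constant for [n] terms, and [n + 1]
    bounds the ratio of any two Sherman-Morrison denominators. The field is a
    parameter because the coefficients are needed in [R] for the function and in
    [R[i]] for its matrix version. *)
Definition gap_coef (F : fieldType) (n : nat) (j : 'I_n.+1) : F :=
  if j == ord_max then -1
  else n%:R * n.+1%:R * (gap_weight F (@ord_max n) / gap_weight F j) ^+ 2.

Lemma gap_weight_neq0 (F : numFieldType) (n : nat) (j : 'I_n.+1) :
  gap_weight F j != 0.
Proof. by apply/prodf_neq0 => k kj; rewrite subr_eq0 eqr_nat. Qed.

Lemma rmorph_gap_coef (F K : fieldType) (phi : {rmorphism F -> K}) (n : nat)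
    (j : 'I_n.+1) : phi (gap_coef F j) = gap_coef K j.
Proof.
have wE (k : 'I_n.+1) : phi (gap_weight F k) = gap_weight K k.
  by rewrite rmorph_prod; apply: eq_bigr => l _; rewrite rmorphB !rmorph_nat.
rewrite /gap_coef; case: ifP => _; first by rewrite rmorphN1.
by rewrite !rmorphM fmorphV !rmorph_nat !wE.
Qed.

(** Here [mu] stands for the eigenvalues of an [n]-dimensional matrix, measured
    from [a], and [w], [b] for the spectral weights of the pairs [(u, v)] and
    [(u, u)]. There are only [n] eigenvalues for [n + 1] poles, so the sums
    [\sum_i w i / (mu i + j.+1%:R)] satisfy a linear relation, and the one with
    the negative coefficient is dominated by the others. *)
Lemma gap_form_ge0 (F : numFieldType) (n : nat) (mu w b : 'I_n -> F) :
  (forall i, 0 <= mu i) -> (forall i, 0 <= b i) ->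
  0 <= \sum_(j < n.+1) gap_coef F j *
    (`|\sum_i w i / (mu i + j.+1%:R)| ^+ 2 /
     (1 + \sum_i b i / (mu i + j.+1%:R))).
Proof.
move=> mu0 b0.
set m := fun j : 'I_n.+1 => \sum_i w i / (mu i + j.+1%:R).
set q := fun j : 'I_n.+1 => \sum_i b i / (mu i + j.+1%:R).
have mus (i : 'I_n) (j : 'I_n.+1) : 0 < mu i + j.+1%:R.
  by rewrite ltr_wpDl ?ltr0n.
pose p (j : 'I_n.+1) : F := - j.+1%:R.
pose P : {poly F} := \prod_i ('X - (mu i)%:P).
have p_inj : injective p.
  by move=> j k /oppr_inj/eqP; rewrite eqr_nat eqSS => /eqP/ord_inj.
have sizeP : (size P <= n.+1)%N by rewrite size_prod_XsubC_card card_ord.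
have Pp j : P.[p j] = \prod_i - (mu i + j.+1%:R).
  rewrite horner_prod; apply: eq_bigr => i _.
  by rewrite hornerXsubC /p opprD addrC.
have pW j : \prod_(k | k != j) (p j - p k) = gap_weight F j.
  by apply: eq_bigr => k _; rewrite /p opprK addrC !mulrS; ring.
(* [P / \prod_j ('X - p j)] vanishes at each eigenvalue *)
have rel0 : \sum_j P.[p j] / gap_weight F j * m j = 0.
  under eq_bigr do rewrite mulr_sumr.
  rewrite exchange_big big1//= => i _.
  have xp j : mu i != p j by rewrite -subr_eq0 /p opprK gt_eqF.
  have := partial_fractions p_inj sizeP xp.
  rewrite {1}/P horner_prod (bigD1 i)//= hornerXsubC subrr !mul0r => /esym.
  move=> /(congr1 ( *%R (w i))); rewrite mulr0 mulr_sumr => rel.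
  rewrite -[RHS]rel; apply: eq_bigr => j _.
  by rewrite pW /p opprK [RHS]mulrCA.
pose rho j : F := P.[p j] / P.[p ord_max].
have Pp0 j : P.[p j] != 0.
  by rewrite Pp; apply/prodf_neq0 => i _; rewrite oppr_eq0 gt_eqF.
(* the last pole is the farthest from the eigenvalues *)
have rho1 j : `|rho j| <= 1.
  rewrite normf_div ler_pdivrMr ?normr_gt0// mul1r !Pp !normr_prod.
  apply: ler_prod => i _; rewrite normr_ge0 !normrN !gtr0_norm// lerD2l.
  by rewrite ler_nat ltnS -ltnS ltn_ord.
pose g (j : 'I_n.+1) : F := gap_weight F (@ord_max n) / gap_weight F j.
have g_real j : g j \is Num.real.
  by rewrite rpredM ?rpredV ?rpred_prod// => k _; rewrite rpredB ?realn.
have mE : m ord_max = - \sum_(j | j != ord_max) rho j * (g j * m j).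
  have W0 := gap_weight_neq0 F (@ord_max n).
  have := rel0; rewrite (bigD1 ord_max)//= addrC => /eqP.
  rewrite addr_eq0 eq_sym eqr_oppLR => /eqP.
  move=> /(congr1 ( *%R (gap_weight F (@ord_max n) / P.[p ord_max]))).
  rewrite [LHS](_ : _ = m ord_max) => [->|]; last by field; rewrite W0 Pp0.
  rewrite mulrN mulr_sumr; congr (- _); apply: eq_bigr => j _.
  by rewrite /rho /g; ring.
have q_ge0 j : 0 <= q j by apply: sumr_ge0 => i _; rewrite divr_ge0// ltW.
have q1_gt0 j : 0 < 1 + q j by rewrite ltr_wpDr.
have mb : `|m ord_max| ^+ 2 <=
    n%:R * \sum_(j | j != ord_max) g j ^+ 2 * `|m j| ^+ 2.
  rewrite mE normrN; apply: (le_trans (sqr_norm_sum_le _ _)).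
  rewrite cardC1 card_ord /= ler_wpM2l ?ler0n//.
  apply: ler_sum => j _.
  have -> : `|rho j * (g j * m j)| ^+ 2 =
      `|rho j| ^+ 2 * (g j ^+ 2 * `|m j| ^+ 2).
    by rewrite -(real_normK (g_real j)) (normrM (rho j)) (normrM (g j)); ring.
  apply: ler_piMl; last by rewrite exprn_ile1.
    by rewrite mulr_ge0 ?(real_exprn_even_ge0 (g_real j))// exprn_ge0.
have qb j : (1 + q ord_max)^-1 <= n.+1%:R / (1 + q j).
  rewrite ler_pdivlMr// ler_pdivrMl// [in leRHS]mulrC mulrDr mulr1.
  rewrite lerD ?ler1n// mulr_sumr; apply: ler_sum => i _.
  rewrite mulrCA ler_wpM2l// ler_pdivlMr// ler_pdivrMl//.
  rewrite -subr_ge0.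
  have -> : (mu i + j.+1%:R) * n.+1%:R - (mu i + (@ord_max n).+1%:R) =
    n%:R * mu i + n.+1%:R * j%:R by rewrite /= -!natr1; ring.
  by rewrite addr_ge0 ?mulr_ge0 ?ler0n.
rewrite (bigD1 ord_max)//= {1}/gap_coef eqxx mulN1r addrC subr_ge0.
rewrite -/(m ord_max) -/(q ord_max).
apply: (le_trans (ler_wpM2r _ mb)); first by rewrite invr_ge0 ltW.
rewrite -mulrA mulr_suml mulr_sumr; apply: ler_sum => j jn.
rewrite /gap_coef (negbTE jn) -/(m j) -/(q j) -/(g j).
move: (g j ^+ 2) (real_exprn_even_ge0 (g_real j) (isT : ~~ odd 2)) => G G0.
have M0 : 0 <= `|m j| ^+ 2 by rewrite exprn_ge0.
move: (`|m j| ^+ 2) M0 (qb j) => M M0 qbj.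
rewrite -!mulrA ler_wpM2l ?ler0n// [leRHS]mulrCA ler_wpM2l//.
by rewrite [leRHS]mulrCA ler_wpM2l.
Qed.

(** The partial fraction expansion of [\prod_(j < n) ('X + j + 1)] over the
    points [la i] provides [v]: the numerator vanishes at all the poles
    [- (j + 1)] except the last one. *)
Lemma gap_annihilator (F : numFieldType) (n : nat) (la : 'I_n.+1 -> F) :
  injective la -> (forall i, 0 <= la i) ->
  exists v : 'I_n.+1 -> F, forall j : 'I_n.+1,
    (\sum_i v i / (la i + j.+1%:R) == 0) = (j != ord_max).
Proof.
move=> la_inj la0.
have las (i j : 'I_n.+1) : 0 < la i + j.+1%:R by rewrite ltr_wpDl ?ltr0n.
pose P : {poly F} := \prod_(j < n) ('X - (- j.+1%:R)%:P).
exists (fun i => P.[la i] / \prod_(k | k != i) (la i - la k)) => j.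
have sizeP : (size P <= n.+1)%N by rewrite size_prod_XsubC_card card_ord.
have xp i : - j.+1%:R != la i by rewrite lt_eqF// -subr_gt0 opprK.
have := partial_fractions la_inj sizeP xp.
under [in X in _ = X -> _]eq_bigr do rewrite -opprD addrC invrN mulrN.
rewrite sumrN => /(congr1 -%R); rewrite opprK => <-.
rewrite oppr_eq0 mulf_eq0 invr_eq0 [X in _ || X]negbTE ?orbF; last first.
  by apply/prodf_neq0 => i _; rewrite subr_eq0.
rewrite horner_prod; have [jn|jn] := eqVneq j ord_max.
  apply/negbTE/prodf_neq0 => i _.
  by rewrite hornerXsubC opprK addrC subr_eq0 eqr_nat eqSS jn ltn_eqF//=.
have jn' : (j < n)%N by rewrite ltn_neqAle -ltnS ltn_ord andbT -val_eqE in jn *.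
by apply/eqP; rewrite (bigD1 (Ordinal jn'))//= hornerXsubC opprK addNr mul0r.
Qed.

(** * Self-adjoint matrices and rank-one perturbations *)

Lemma adjmxM (C : numClosedFieldType) m n p
    (A : 'M[C]_(m, n)) (B : 'M[C]_(n, p)) :
  (A *m B)^t* = B^t* *m A^t*.
Proof. by rewrite trmx_mul map_mxM. Qed.

Lemma hermsymmxP (C : numClosedFieldType) n (A : 'M[C]_n) :
  reflect (A^t* = A) (A \is hermsymmx).
Proof.
by apply: (iffP (is_hermitianmxP _ _ _)); rewrite expr0 scale1r.
Qed.

Lemma hermsymmx_addr (C : numClosedFieldType) n (A B : 'M[C]_n) :
  A \is hermsymmx -> B \is hermsymmx -> A + B \is hermsymmx.
Proof.
move=> /hermsymmxP AE /hermsymmxP BE.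
by apply/hermsymmxP; rewrite linearD map_mxD AE BE.
Qed.

Lemma hermsymmx_subr (C : numClosedFieldType) n (A B : 'M[C]_n) :
  A \is hermsymmx -> B \is hermsymmx -> A - B \is hermsymmx.
Proof.
move=> /hermsymmxP AE /hermsymmxP BE.
by apply/hermsymmxP; rewrite linearB map_mxB AE BE.
Qed.

Lemma hermsymmx_scale (C : numClosedFieldType) n (c : C) (A : 'M[C]_n) :
  c \is Num.real -> A \is hermsymmx -> c *: A \is hermsymmx.
Proof.
move=> /CrealP cE /hermsymmxP AE.
by apply/hermsymmxP; rewrite linearZ map_mxZ AE/= cE.
Qed.

Lemma hermsymmx_scalar (C : numClosedFieldType) n (c : C) :
  c \is Num.real -> (c%:M : 'M[C]_n) \is hermsymmx.
Proof.
move=> /CrealP cE.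
by apply/hermsymmxP; rewrite tr_scalar_mx map_scalar_mx/= cE.
Qed.

Lemma hermsymmx_mul_adj (C : numClosedFieldType) m n (A : 'M[C]_(m, n)) :
  A *m A^t* \is hermsymmx.
Proof. by apply/hermsymmxP; rewrite adjmxM trmxCK. Qed.

Lemma hermsymmx_invmx (C : numClosedFieldType) n (A : 'M[C]_n) :
  A \is hermsymmx -> invmx A \is hermsymmx.
Proof.
move=> /hermsymmxP AE.
by apply/hermsymmxP; rewrite trmx_inv map_invmx AE.
Qed.

(** The Sherman-Morrison formula. *)
Lemma invmx_rank1 (F : fieldType) n (A : 'M[F]_n) (u : 'cV[F]_n)
    (w : 'rV[F]_n) :
  A \in unitmx -> 1 + (w *m invmx A *m u) 0 0 != 0 ->
  invmx A - invmx (A + u *m w) =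
  (1 + (w *m invmx A *m u) 0 0)^-1 *: (invmx A *m u *m (w *m invmx A)).
Proof.
move=> Au; set q := (_ *m u) 0 0; set R := invmx A => q0.
set S := R - (1 + q)^-1 *: (R *m u *m (w *m R)).
have qE : w *m R *m u = q%:M by rewrite [LHS]mx11_scalar.
have SE : (A + u *m w) *m S = 1%:M.
  have RE : (A + u *m w) *m R = 1%:M + u *m (w *m R).
    by rewrite mulmxDl mulmxV// mulmxA.
  rewrite /S mulmxBr -scalemxAr RE (mulmxA _ (R *m u)) (mulmxA _ R u) RE.
  rewrite mulmxDl mul1mx -(mulmxA u) qE mul_mx_scalar -[X in X + q *: _]scale1r.
  by rewrite -scalerDl -scalemxAl scalerA mulVf// scale1r addrK.
have [ABu Su] := mulmx1_unit SE.
by rewrite -[invmx (_ + _)]mulmx1 -SE mulKmx// opprB addrC subrK.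
Qed.

Lemma diag_form (C : numClosedFieldType) n (U : 'M[C]_n) (d : 'rV[C]_n)
    (u v : 'cV[C]_n) :
  U \is unitarymx ->
  (u^t* *m (invmx U *m diag_mx d *m U) *m v) 0 0 =
  \sum_i (((U *m u) i 0)^* * (U *m v) i 0 * d 0 i).
Proof.
move=> UU; rewrite invmx_unitary// !mulmxA -adjmxM -mulmxA mxE.
by apply: eq_bigr => i _; rewrite mul_mx_diag !mxE; ring.
Qed.

Lemma diag_shift (C : numClosedFieldType) n (U : 'M[C]_n) (d : 'rV[C]_n)
    (s : C) : U \is unitarymx ->
  invmx U *m diag_mx d *m U + s%:M =
  invmx U *m diag_mx (\row_i (d 0 i + s)) *m U.
Proof.
move=> /unitarymx_unit Uu.
rewrite -[s%:M in LHS]mulmx1 -(mulVmx Uu) mul_scalar_mx scalemxAl -mulmxDl.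
rewrite -[s *: _](mul_mx_scalar) -mulmxDr; congr (invmx U *m _ *m U).
apply/matrixP => i j; rewrite !mxE; case: eqP => _; first by rewrite !mulr1n.
by rewrite !mulr0n addr0.
Qed.

Lemma invmx_diag_shift (C : numClosedFieldType) n (U : 'M[C]_n)
    (d : 'rV[C]_n) (s : C) :
  U \is unitarymx -> (forall i, d 0 i + s != 0) ->
  (invmx U *m diag_mx d *m U + s%:M \in unitmx) /\
  invmx (invmx U *m diag_mx d *m U + s%:M) =
  invmx U *m diag_mx (\row_i (d 0 i + s)^-1) *m U.
Proof.
move=> UU d0; have Uu := unitarymx_unit UU; rewrite diag_shift//.
set A := _ *m U; set S := RHS.
have AS : A *m S = 1%:M.
  rewrite /S !mulmxA mulmxK// -[X in X *m U]mulmxA mulmx_diag.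
  rewrite (_ : \row_j _ = const_mx 1) ?diag_const_mx ?mulmx1 ?mulVmx//.
  by apply/rowP => i; rewrite !mxE mulfV.
have [Au _] := mulmx1_unit AS; split=> //.
by rewrite -[LHS]mulmx1 -AS mulKmx.
Qed.

(** * Spectral decompositions and quadratic forms *)

Lemma real_complex_real (R : realType) (t : R) : t%:C \is Num.real.
Proof. by apply/complex_realP; exists t. Qed.

(** The spectral theorem with real eigenvalues, known to lie in [J]. *)
Lemma hermsymmx_spectral (R : realType) n (J : set R) (x : 'M[R[i]]_n) :
  x \is hermsymmx ->
  (forall z : R[i], eigenvalue x z -> exists2 t, J t & z = t%:C) ->
  exists (U : 'M[R[i]]_n) (d : 'rV[R]_n), [/\ U \is unitarymx,
    forall i, J (d 0 i) &
    x = invmx U *m diag_mx (map_mx (real_complex R) d) *m U].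
Proof.
move=> xh xJ; have /hermitian_normalmx /orthomx_spectralP xE := xh.
set U := spectralmx x in xE; set e := spectral_diag x in xE.
have UU : U \is unitarymx by exact: spectral_unitarymx.
have Uu := unitarymx_unit UU.
have eJ i : exists t, J t /\ e 0 i = t%:C.
  have [|t Jt ->] := xJ (e 0 i); last by exists t.
  apply/eigenvalueP; exists (row i U).
    rewrite {1}xE -row_mul !mulmxA mulmxV// mul1mx row_mul row_diag_mx.
    by rewrite -scalemxAl -rowE.
  apply: contraTneq isT => Ui0; have /row_unitarymxP/(_ i i) := UU.
  by rewrite Ui0 eqxx linear0l => /eqP; rewrite eq_sym oner_eq0.
have [d dP] := choice eJ.
exists U, (\row_i d i); split; first exact: UU.
  by move=> i; rewrite mxE; case: (dP i).
rewrite [LHS]xE; congr (invmx U *m diag_mx _ *m U).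
by apply/rowP => i; rewrite !mxE; case: (dP i).
Qed.

Lemma psdmx0 (R : realType) n : psdmx (0 : 'M[R[i]]_n).
Proof.
split=> [|v]; first by apply/hermsymmxP; rewrite trmx0 map_mx0.
by rewrite mulmx0 mul0mx mxE.
Qed.

Lemma psdmx_add (R : realType) n (x y : 'M[R[i]]_n) :
  psdmx x -> psdmx y -> psdmx (x + y).
Proof.
move=> [xh x0] [yh y0]; split=> [|v]; first exact: hermsymmx_addr xh yh.
by rewrite mulmxDr mulmxDl mxE addr_ge0.
Qed.

Lemma sqr_norm_form (R : realType) n (v : 'cV[R[i]]_n) :
  (v^t* *m v) 0 0 = \sum_i `|v i 0| ^+ 2.
Proof. by rewrite mxE; apply: eq_bigr => i _; rewrite !mxE mulrC -normCK. Qed.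

Lemma sqr_norm_gt0 (R : realType) n (v : 'cV[R[i]]_n) :
  v != 0 -> 0 < (v^t* *m v) 0 0.
Proof.
move=> v0; rewrite sqr_norm_form lt_def sumr_ge0 ?andbT => [|i _]; last first.
  by rewrite exprn_ge0.
apply: contra v0 => /eqP v0; apply/eqP/colP => i; rewrite mxE.
have v_ge0 k (_ : true) : 0 <= `|v k 0| ^+ 2 by rewrite exprn_ge0.
have /eqP := psumr_eq0P v_ge0 v0 (i := i) isT.
by rewrite sqrf_eq0 normr_eq0 => /eqP.
Qed.

Lemma rank1_form (R : realType) n (u v : 'cV[R[i]]_n) :
  (v^t* *m (u *m u^t*) *m v) 0 0 = `|(u^t* *m v) 0 0| ^+ 2.
Proof.
have : v^t* *m (u *m u^t*) *m v = (u^t* *m v)^t* *m (u^t* *m v).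
  by rewrite adjmxM trmxCK !mulmxA.
by move=> ->; rewrite sqr_norm_form big_ord1.
Qed.

Lemma psdmx_rank1 (R : realType) n (u : 'cV[R[i]]_n) : psdmx (u *m u^t*).
Proof.
split=> [|v]; first exact: hermsymmx_mul_adj.
by rewrite rank1_form exprn_ge0.
Qed.

Lemma eigenvalue_form (R : realType) n (x : 'M[R[i]]_n) (z : R[i]) :
  eigenvalue x z ->
  exists2 v : 'cV[R[i]]_n, v != 0 &
   (v^t* *m x *m v) 0 0 = z * (v^t* *m v) 0 0.
Proof.
case/eigenvalueP => w wE w0; exists (w^t*).
  by apply: contra w0 => /eqP w0; rewrite -[w]trmxCK w0 trmx0 map_mx0.
by rewrite trmxCK wE -scalemxAl mxE.
Qed.

(** An eigenvalue is the value of the form at a normalized eigenvector. *)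
Lemma eigenvalue_form_bounds (R : realType) n (s t : R) (x : 'M[R[i]]_n) :
  x \is hermsymmx ->
  (forall v : 'cV[R[i]]_n, s%:C * (v^t* *m v) 0 0 <= (v^t* *m x *m v) 0 0) ->
  (forall v : 'cV[R[i]]_n, (v^t* *m x *m v) 0 0 <= t%:C * (v^t* *m v) 0 0) ->
  forall z, eigenvalue x z -> exists2 r, s <= r <= t & z = r%:C.
Proof.
move=> xh sx xt z /eigenvalue_form[v v0 vE].
have := sx v; have := xt v; rewrite vE !ler_pM2r ?sqr_norm_gt0// => zt sz.
have /complex_realP[r rE] : z \is Num.real.
  by rewrite -(subrK s%:C z) realD ?real_complex_real// ger0_real// subr_ge0.
by exists r => //; rewrite rE !lecR in sz zt; rewrite sz.
Qed.

Lemma psdmx_spectral (R : realType) n (x : 'M[R[i]]_n) : psdmx x ->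
  exists (U : 'M[R[i]]_n) (d : 'rV[R]_n), [/\ U \is unitarymx,
    forall i, 0 <= d 0 i &
    x = invmx U *m diag_mx (map_mx (real_complex R) d) *m U].
Proof.
move=> [xh x0].
have [|U [d [UU dJ xE]]] := @hermsymmx_spectral R n [set t | 0 <= t] x xh.
  move=> z /eigenvalue_form[v v0 vE].
  have := x0 v; rewrite vE pmulr_lge0 ?sqr_norm_gt0// => z0.
  have /complex_realP[r rE] := ger0_real z0.
  by exists r => //=; rewrite -ler0c -rE.
by exists U, d.
Qed.

(** Splitting a perturbation into rank-one pieces reduces monotonicity to the
    Sherman-Morrison formula. *)
Lemma psdmx_sum_rank1 (R : realType) n (x : 'M[R[i]]_n) : psdmx x ->
  exists u : 'I_n -> 'cV[R[i]]_n, x = \sum_k u k *m (u k)^t*.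
Proof.
move=> /psdmx_spectral[U [d [UU d0 xE]]].
exists (fun k => (Num.sqrt (d 0 k))%:C *: (row k U)^t*).
rewrite xE invmx_unitary//; apply/matrixP => i j.
rewrite mxE summxE; apply: eq_bigr => k _.
rewrite mul_mx_diag !mxE big_ord1 !mxE rmorphM/= conjCK.
rewrite (CrealP (real_complex_real _)).
by rewrite -[in LHS](sqr_sqrtr (d0 k)) rmorphXn/=; ring.
Qed.

(** * The function and its monotonicity in dimension n *)

Definition gap_fun (R : realType) (n : nat) (a t : R) : R :=
  - \sum_(j < n.+1) gap_coef R j / (t - a + j.+1%:R).

(** [gap_fun n 0] of a positive semidefinite matrix, as a combination of
    resolvents: in this form it can be perturbed without diagonalizing the
    perturbed matrix. *)
Definition gap_mx (R : realType) (n m : nat) (x : 'M[R[i]]_m) : 'M[R[i]]_m :=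
  - \sum_(j < n.+1) gap_coef R[i] j *: invmx (x + j.+1%:R%:M).

Lemma gap_mx_diag (R : realType) n m (U : 'M[R[i]]_m) (d : 'rV[R]_m) :
  U \is unitarymx -> (forall i, 0 <= d 0 i) ->
  gap_mx n (invmx U *m diag_mx (map_mx (real_complex R) d) *m U) =
  invmx U *m diag_mx (map_mx (real_complex R \o gap_fun n 0) d) *m U.
Proof.
move=> UU d0; set D := map_mx (real_complex R) d.
have D0 (j : nat) i : D 0 i + j.+1%:R != 0.
  by rewrite mxE gt_eqF// ltr_wpDl ?ltr0n// ler0c.
have resE (j : 'I_n.+1) :
    gap_coef R[i] j *: invmx (invmx U *m diag_mx D *m U + j.+1%:R%:M) =
    invmx U *m (gap_coef R[i] j *: diag_mx (\row_i (D 0 i + j.+1%:R)^-1)) *m U.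
  have [_ ->] := invmx_diag_shift UU (D0 j).
  by rewrite scalemxAl scalemxAr.
rewrite /gap_mx (eq_bigr _ (fun j _ => resE j)).
rewrite -mulmx_suml -mulmx_sumr -mulNmx -mulmxN; congr (invmx U *m _ *m U).
apply/matrixP => i k; rewrite !mxE summxE/=.
have [->|ik] := eqVneq i k; last first.
  rewrite mulr0n big1 ?oppr0// => j _.
  by rewrite !mxE (negbTE ik) mulr0n mulr0.
rewrite mulr1n /gap_fun rmorphN rmorph_sum/=; congr (- _).
apply: eq_bigr => j _; rewrite !mxE eqxx mulr1n rmorphM fmorphV subr0.
by rewrite rmorph_gap_coef rmorphD rmorph_nat.
Qed.

(** Both conclusions come from the same diagonalization of [x]; the first one is
    what makes every resolvent in [gap_mx] exist. *)
Lemma funcalc_gap_fun (R : realType) n m (a : R) (x : 'M[R[i]]_m) :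
  x \is hermsymmx ->
  (forall z : R[i], eigenvalue x z -> exists2 t, a <= t & z = t%:C) ->
  psdmx (x - a%:C%:M) /\
  funcalc (gap_fun n a) x = gap_mx n (x - a%:C%:M).
Proof.
move=> xh xa.
have [U [d [UU da xE]]] := @hermsymmx_spectral R m [set t | a <= t] x xh xa.
have yE : x - a%:C%:M =
    invmx U *m diag_mx (map_mx (real_complex R) (\row_i (d 0 i - a))) *m U.
  rewrite {1}xE -[- _]raddfN (diag_shift _ _ UU).
  congr (invmx U *m diag_mx _ *m U).
  by apply/rowP => i; rewrite !mxE rmorphB.
split.
  split=> [|v].
    exact/(hermsymmx_subr xh)/hermsymmx_scalar/real_complex_real.
  rewrite yE diag_form//; apply: sumr_ge0 => i _.
  rewrite [X in X * _]mulrC -normCK !mxE mulr_ge0 ?exprn_ge0// ler0c subr_ge0.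
  exact: da.
have d0 i : 0 <= (\row_i (d 0 i - a)) 0 i by rewrite mxE subr_ge0; exact: da.
rewrite yE (gap_mx_diag n UU d0) [in LHS]xE (funcalc_diag _ _ UU).
congr (invmx U *m diag_mx _ *m U).
by apply/rowP => i; rewrite !mxE/= /gap_fun subr0.
Qed.

(** Sherman-Morrison in each resolvent; the result involves only the spectral
    decomposition of the unperturbed matrix [x]. *)
Lemma gap_mx_rank1_form (R : realType) n m (x U : 'M[R[i]]_m)
    (d : 'rV[R]_m) (u v : 'cV[R[i]]_m) :
  x \is hermsymmx -> U \is unitarymx -> (forall i, 0 <= d 0 i) ->
  x = invmx U *m diag_mx (map_mx (real_complex R) d) *m U ->
  (v^t* *m (gap_mx n (x + u *m u^t*) - gap_mx n x) *m v) 0 0 =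
  \sum_(j < n.+1) gap_coef R[i] j *
    (`|\sum_i ((U *m u) i 0)^* * (U *m v) i 0 / ((d 0 i)%:C + j.+1%:R)| ^+ 2 /
     (1 + \sum_i `|(U *m u) i 0| ^+ 2 / ((d 0 i)%:C + j.+1%:R))).
Proof.
move=> xh UU d0; set D := map_mx (real_complex R) d => xD.
have D0 (j : nat) i : 0 < D 0 i + j.+1%:R.
  by rewrite mxE ltr_wpDl ?ltr0n// ler0c.
have D0' (j : nat) i : D 0 i + j.+1%:R != 0 by rewrite gt_eqF.
rewrite /gap_mx opprK addrC -sumrB mulmx_sumr mulmx_suml summxE.
apply: eq_bigr => j _.
rewrite -scalerBr -scalemxAr -scalemxAl mxE; congr (_ * _).
have := invmx_diag_shift UU (D0' j); rewrite -xD => -[xu xE].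
rewrite addrAC; set q := (X in 1 + X).
have qE : (u^t* *m invmx (x + j.+1%:R%:M) *m u) 0 0 = q.
  rewrite xE diag_form//; apply: eq_bigr => i _.
  by rewrite [X in X * _]mulrC -normCK [X in _ * X]mxE [D 0 i]mxE.
have q0 : 0 <= q.
  apply: sumr_ge0 => i _; rewrite divr_ge0 ?exprn_ge0// ltW//.
  by have := D0 j i; rewrite mxE.
rewrite invmx_rank1 ?qE//; last by rewrite gt_eqF// ltr_wpDr.
rewrite -scalemxAr -scalemxAl mxE mulrC; congr (_ * _).
have rh : invmx (x + j.+1%:R%:M) \is hermsymmx.
  apply: hermsymmx_invmx; apply: (hermsymmx_addr xh).
  by apply: hermsymmx_scalar; rewrite realn.
set r := invmx _ in rh xE *.
have -> : r *m u *m (u^t* *m r) = (r *m u) *m (r *m u)^t*.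
  by rewrite adjmxM (hermsymmxP _ rh).
rewrite rank1_form adjmxM (hermsymmxP _ rh) xE diag_form//.
congr (`|_| ^+ 2); apply: eq_bigr => i _.
by rewrite [X in _ * X]mxE [D 0 i]mxE.
Qed.

Lemma hermsymmx_gap_mx (R : realType) n m (x : 'M[R[i]]_m) :
  x \is hermsymmx -> gap_mx n x \is hermsymmx.
Proof.
move=> xh; rewrite /gap_mx -scaleN1r.
apply: hermsymmx_scale; first exact: rpredN1.
apply: (big_ind (fun y : 'M[R[i]]_m => y \is hermsymmx)) => [||j _].
- by apply/hermsymmxP; rewrite trmx0 map_mx0.
- exact: hermsymmx_addr.
apply: hermsymmx_scale.
  by rewrite -(rmorph_gap_coef (real_complex R)) real_complex_real.
apply/hermsymmx_invmx/(hermsymmx_addr xh).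
by apply: hermsymmx_scalar; rewrite realn.
Qed.

(** The parameter of [gap_mx] is the dimension of the matrix: this is where the
    number of eigenvalues enters, through [gap_form_ge0]. *)
Lemma gap_mx_rank1_le (R : realType) n (x : 'M[R[i]]_n) (u : 'cV[R[i]]_n) :
  psdmx x ->
  loewner_le (gap_mx n x) (gap_mx n (x + u *m u^t*)).
Proof.
move=> xp; have [uh _] := psdmx_rank1 u; have [xh _] := xp.
split=> [|v].
  apply: hermsymmx_subr; apply: hermsymmx_gap_mx; last exact: xh.
  exact: hermsymmx_addr xh uh.
have [U [d [UU d0 xE]]] := psdmx_spectral xp.
rewrite (gap_mx_rank1_form n u v xh UU d0 xE).
apply: (@gap_form_ge0 R[i] n (fun i => (d 0 i)%:C)) => i.
  by rewrite ler0c.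
by rewrite exprn_ge0.
Qed.

(** All the intermediate matrices are positive semidefinite, so that each
    rank-one step is covered by [gap_mx_rank1_le]. *)
Lemma gap_mx_monotone (R : realType) n (x y : 'M[R[i]]_n) :
  psdmx x -> loewner_le x y ->
  loewner_le (gap_mx n x) (gap_mx n y).
Proof.
move=> xp /psdmx_sum_rank1[u yE].
have {yE}-> : y = x + \sum_k u k *m (u k)^t* by rewrite -yE addrC subrK.
suff: forall s, psdmx (x + \sum_(k <- s) u k *m (u k)^t*) /\
    loewner_le (gap_mx n x) (gap_mx n (x + \sum_(k <- s) u k *m (u k)^t*)).
  by move=> /(_ (index_enum 'I_n))[].
elim=> [|k s [IHp IHle]].
  rewrite big_nil addr0; split; first exact: xp.
  by rewrite /loewner_le subrr; exact: psdmx0.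
rewrite big_cons addrCA addrC; split.
  exact: psdmx_add IHp (psdmx_rank1 _).
rewrite /loewner_le -(subrKA (gap_mx n (x + \sum_(k <- s) u k *m (u k)^t*))).
exact: psdmx_add (gap_mx_rank1_le _ IHp) IHle.
Qed.

Lemma gap_fun_monotone (R : realType) n (a : R) (J : set R) :
  J `<=` `[a, +oo[%classic ->
  matrix_monotone n J (gap_fun n a).
Proof.
move=> Ja; split.
  apply: continuous_in_subspaceT => t /set_mem/Ja.
  rewrite /= in_itv/= andbT => ta.
  apply: cvgN; apply: (@cvg_big _ _ +%R) => [|j _]; first exact: add_continuous.
  apply: cvgM; first exact: cvg_cst.
  apply: cvgV; last by apply: cvgD (cvg_cst _); apply: cvgB (cvg_cst _).
  by rewrite gt_eqF// ltr_wpDl ?subr_ge0.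
have Ja' (x : 'M[R[i]]_n) :
  (forall z : R[i], eigenvalue x z -> exists2 t, J t & z = t%:C) ->
  (forall z : R[i], eigenvalue x z -> exists2 t, a <= t & z = t%:C).
  move=> xJ z /xJ[t /Ja]; rewrite /= in_itv/= andbT.
  by exists t.
move=> x y xh yh /Ja' xa /Ja' ya xy.
have [xp ->] := funcalc_gap_fun n xh xa.
have [_ ->] := funcalc_gap_fun n yh ya.
apply: (gap_mx_monotone xp).
by rewrite /loewner_le opprB subrKA; exact: xy.
Qed.

(** * Failure of monotonicity in dimension n + 1 *)

Lemma hermsymmx_real_diag (R : realType) n (d : 'rV[R]_n) :
  diag_mx (map_mx (real_complex R) d) \is hermsymmx.
Proof.
apply/hermsymmxP; rewrite tr_diag_mx map_diag_mx; congr diag_mx.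
by apply/rowP => i; rewrite !mxE; exact: (CrealP (real_complex_real _)).
Qed.

Lemma real_diag_form (R : realType) n (d : 'rV[R]_n) (v : 'cV[R[i]]_n) :
  (v^t* *m diag_mx (map_mx (real_complex R) d) *m v) 0 0 =
  \sum_i `|v i 0| ^+ 2 * (d 0 i)%:C.
Proof.
rewrite mxE; apply: eq_bigr => i _.
by rewrite mul_mx_diag !mxE mulrAC [X in X * _]mulrC -normCK.
Qed.

(** Only the last pole has a negative coefficient, so a test vector whose
    pairings with all the other resolvents vanish makes the form of
    [gap_mx_rank1_form] strictly negative. In dimension [n + 1] such a vector is
    provided by [gap_annihilator]; the matrix [x] is diagonal with simple
    spectrum and every entry of [u] is nonzero, hence no coordinate is lost. *)
Lemma gap_mx_rank1_not_le (R : realType) n (d : 'rV[R]_n.+1) (e : R)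
    (x := diag_mx (map_mx (real_complex R) d))
    (u : 'cV[R[i]]_n.+1 := const_mx e%:C) :
  (forall i, 0 <= d 0 i) -> injective (d 0) -> e != 0 ->
  ~ loewner_le (gap_mx n x) (gap_mx n (x + u *m u^t*)).
Proof.
move=> d0 d_inj e0 [_].
have eC0 : e%:C != 0  by rewrite fmorph_eq0.
have xE : x = invmx 1%:M *m x *m 1%:M by rewrite invmx1 mul1mx mulmx1.
have U1 : (1%:M : 'M[R[i]]_n.+1) \is unitarymx.
  by apply/unitarymxP; rewrite trmx1 map_mx1 mulmx1.
have [v vP] := @gap_annihilator R[i] n (fun i => (d 0 i)%:C)
  (fun i j ij => d_inj _ _ (complexI ij))
  (fun i => etrans (ler0c _) (d0 i)).
(* dividing by the entries of [u] makes the weights of the pairings equal to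
   the coordinates of [v] *)
pose w : 'cV[R[i]]_n.+1 := \col_i (v i / e%:C).
move=> /(_ w).
rewrite (gap_mx_rank1_form n u w (hermsymmx_real_diag d) U1 d0 xE).
have mE (j : 'I_n.+1) : \sum_i ((1%:M *m u) i 0)^* * (1%:M *m w) i 0 /
      ((d 0 i)%:C + j.+1%:R) = \sum_i v i / ((d 0 i)%:C + j.+1%:R).
  apply: eq_bigr => i _; rewrite !mul1mx !mxE (CrealP (real_complex_real _)).
  by rewrite [X in X / _]mulrC divfK.
under eq_bigr do rewrite mE.
rewrite (bigD1 ord_max)//= [X in _ + X]big1 ?addr0 => [|j jn]; last first.
  have /eqP-> : \sum_i v i / ((d 0 i)%:C + j.+1%:R) == 0 by rewrite vP.
  by rewrite normr0 expr0n/= mul0r mulr0.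
rewrite /gap_coef eqxx mulN1r oppr_ge0 => /le_gtF/negP; apply.
rewrite divr_gt0//.
  have /negbT m0 := etrans (vP ord_max) (congr1 negb (eqxx _)).
  by rewrite exprn_gt0// normr_gt0; exact: m0.
rewrite ltr_wpDr// sumr_ge0// => i _; rewrite divr_ge0 ?exprn_ge0//.
by rewrite addr_ge0// ler0c.
Qed.

(** Both ingredients of [gap_mx_rank1_not_le] can be squeezed into any interval
    with more than one point: equally spaced eigenvalues in its left half, and a
    rank-one perturbation of norm at most half its length. *)
Lemma gap_fun_not_monotone (R : realType) n (a : R) (J : set R) :
  nontrivial_interval J -> J `<=` `[a, +oo[%classic ->
  ~ matrix_monotone n.+1 J (gap_fun n a).
Proof.
move=> [Ji [s0 [t0 [Js0 Jt0 st0]]]] Ja [_ Jmon].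
have [s [t [Js Jt st]]] : exists s t, [/\ J s, J t & s < t].
  have [st|ts|ste] := ltgtP s0 t0; [by exists s0, t0|by exists t0, s0|].
  by rewrite ste eqxx in st0.
have sa : a <= s by have := Ja _ Js; rewrite /= in_itv/= andbT.
pose h := (t - s) / 2.
have h0 : 0 < h by rewrite divr_gt0// subr_gt0.
have sht : s + h + h = t by rewrite /h; field.
clearbody h.
pose la (i : 'I_n.+1) : R := s - a + h * (i%:R / n.+1%:R).
have la_ge i : s - a <= la i.
  by rewrite lerDl mulr_ge0 ?divr_ge0 ?ler0n ?(ltW h0).
have la_le i : la i <= s - a + h.
  rewrite lerD2l ler_piMr ?(ltW h0)// ler_pdivrMr ?ltr0n// mul1r ler_nat.
  exact: ltnW (ltn_ord i).
have la_inj : injective la.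
  move=> i j /addrI/(mulfI (lt0r_neq0 h0))/mulIf; rewrite invr_eq0 pnatr_eq0.
  by move=> /(_ isT)/eqP; rewrite eqr_nat => /eqP/ord_inj.
clearbody la.
(* [u *m u^t*] has norm [(n + 1) * e ^+ 2 = h] *)
pose e := Num.sqrt (h / n.+1%:R).
have eE : e ^+ 2 = h / n.+1%:R by rewrite sqr_sqrtr ?divr_ge0 ?ltW.
have e0 : e != 0 by rewrite gt_eqF// sqrtr_gt0 divr_gt0.
clearbody e.
pose d := \row_i la i.
pose x0 : 'M[R[i]]_n.+1 := diag_mx (map_mx (real_complex R) d).
pose u : 'cV[R[i]]_n.+1 := const_mx e%:C.
have x0h : x0 \is hermsymmx := hermsymmx_real_diag d.
have ah : (a%:C%:M : 'M[R[i]]_n.+1) \is hermsymmx.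
  exact/hermsymmx_scalar/real_complex_real.
have [uh _] := psdmx_rank1 u.
pose x := x0 + a%:C%:M; pose y := x0 + u *m u^t* + a%:C%:M.
have xh : x \is hermsymmx by exact: hermsymmx_addr x0h ah.
have yh : y \is hermsymmx by exact: hermsymmx_addr (hermsymmx_addr x0h uh) ah.
have yx : y = x + u *m u^t* by rewrite /y addrAC.
have x_form (v : 'cV[R[i]]_n.+1) :
    (v^t* *m x *m v) 0 0 = \sum_i `|v i 0| ^+ 2 * (la i + a)%:C.
  rewrite mulmxDr mulmxDl mxE real_diag_form mul_mx_scalar -scalemxAl mxE.
  rewrite sqr_norm_form mulr_sumr -big_split; apply: eq_bigr => i _ /=.
  by rewrite mxE rmorphD mulrDr [X in _ + X]mulrC.
have y_form (v : 'cV[R[i]]_n.+1) : (v^t* *m y *m v) 0 0 =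
    (v^t* *m x *m v) 0 0 + `|(u^t* *m v) 0 0| ^+ 2.
  by rewrite -rank1_form yx mulmxDr mulmxDl [LHS]mxE.
have x_ge (v : 'cV[R[i]]_n.+1) : s%:C * (v^t* *m v) 0 0 <= (v^t* *m x *m v) 0 0.
  rewrite sqr_norm_form x_form mulr_sumr; apply: ler_sum => i _.
  by rewrite mulrC ler_wpM2l ?exprn_ge0// lecR -lerBlDr.
have x_le (v : 'cV[R[i]]_n.+1) :
    (v^t* *m x *m v) 0 0 <= (s + h)%:C * (v^t* *m v) 0 0.
  rewrite sqr_norm_form x_form mulr_sumr; apply: ler_sum => i _.
  by rewrite [leRHS]mulrC ler_wpM2l ?exprn_ge0// lecR -lerBrDr addrAC.
have u_le (v : 'cV[R[i]]_n.+1) :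
    `|(u^t* *m v) 0 0| ^+ 2 <= h%:C * (v^t* *m v) 0 0.
  have -> : (u^t* *m v) 0 0 = e%:C * \sum_i v i 0.
    rewrite mxE mulr_sumr; apply: eq_bigr => i _.
    by rewrite !mxE (CrealP (real_complex_real _)).
  rewrite normrM exprMn real_normK ?real_complex_real// -rmorphXn/=.
  rewrite eE sqr_norm_form.
  apply: (le_trans (ler_wpM2l _ (sqr_norm_sum_le _ _))).
    by rewrite ler0c divr_ge0// ltW.
  rewrite card_ord mulrA; apply: ler_wpM2r.
    by apply: sumr_ge0 => i _; exact: exprn_ge0.
  by rewrite -(rmorph_nat (real_complex R)) -rmorphM lecR/= divfK ?pnatr_eq0.
have inJ r : s <= r <= t -> J r by move=> rst; exact: (Ji s t).
have sht_le : s + h <= t by rewrite -sht lerDl ltW.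
have xJ z : eigenvalue x z -> exists2 r, J r & z = r%:C.
  move=> /(eigenvalue_form_bounds xh x_ge x_le)[r /andP[sr rt] ->].
  by exists r => //; apply: inJ; rewrite sr (le_trans rt).
have yJ z : eigenvalue y z -> exists2 r, J r & z = r%:C.
  have y_ge (v : 'cV[R[i]]_n.+1) :
      s%:C * (v^t* *m v) 0 0 <= (v^t* *m y *m v) 0 0.
    by rewrite y_form (le_trans (x_ge v))// lerDl exprn_ge0.
  have y_le (v : 'cV[R[i]]_n.+1) :
      (v^t* *m y *m v) 0 0 <= t%:C * (v^t* *m v) 0 0.
    by rewrite y_form -sht [(s + h + h)%:C]rmorphD mulrDl lerD.
  move=> /(eigenvalue_form_bounds yh y_ge y_le)[r rst ->].
  by exists r => //; exact: inJ.
have xy : loewner_le x y.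
  by rewrite /loewner_le yx addrC addKr; exact: psdmx_rank1.
have JA (z : R[i]) :
  (exists2 r, J r & z = r%:C) -> exists2 r, a <= r & z = r%:C.
  by move=> [r /Ja]; rewrite /= in_itv/= andbT; exists r.
have [_ fx] := funcalc_gap_fun n xh (fun z zx => JA z (xJ z zx)).
have [_ fy] := funcalc_gap_fun n yh (fun z zy => JA z (yJ z zy)).
have := Jmon x y xh yh xJ yJ xy; rewrite fx fy /x /y !addrK.
apply: gap_mx_rank1_not_le => // [i|i j].
  by rewrite mxE (le_trans _ (la_ge i))// subr_ge0.
by rewrite !mxE; exact: la_inj.
Qed.

(** * Existence of the gap *)

Theorem corollary4 (R : realType) (a b : R) (I : set R) (n : nat) :
  a < b ->
  I = `[a, b[%classic \/ I = `[a, +oo[%classic ->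
  (1 <= n)%N ->
  exists f : R -> R,
    matrix_monotone n I f /\
    (~ matrix_monotone n.+1 I f /\
     forall J : set R, nontrivial_interval J -> J `<=` I ->
       ~ matrix_monotone n.+1 J f).
Proof.
move=> ab IE _; exists (gap_fun n a).
have Ia : I `<=` `[a, +oo[%classic.
  by case: IE => -> t //=; rewrite !in_itv/= andbT => /andP[].
have Int : nontrivial_interval I.
  split; first by case: IE => ->; exact: interval_is_interval.
  exists a, ((a + b) / 2); rewrite lt_eqF ?midf_lt//; split=> //.
    by case: IE => -> /=; rewrite in_itv/= lexx ?ab.
  by case: IE => -> /=; rewrite in_itv/= ltW ?midf_lt.
split; first exact: gap_fun_monotone.
split; first exact: gap_fun_not_monotone.
by move=> J Jnt JI; apply: gap_fun_not_monotone => // t /JI; exact: Ia.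
Qed.
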